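(* Let $G$ be a finite simple graph on $n\geq 60$ vertices with an edge-coloring $C:E(G)\to\mathbb{N}^{+}$. For a vertex $v$, let $CN(v)$ denote the set of colors $C(e)$ of the edges $e$ of $G$ incident to $v$. Suppose that $|CN(u)\cup CN(v)|\geq n-1$ for every pair of distinct vertices $u,v$ of $G$. Then $G$ contains a heterochromatic cycle of length $4$, i.e., a cycle $x_1x_2x_3x_4x_1$ in $G$ whose four edges have four pairwise distinct colors.
   Context: An edge-coloring of a graph is an arbitrary function from its edge set to the positive integers (it need not be proper). A subgraph is called heterochromatic if every two of its edges have different colors. *)

(* Defs.v *)
From mathcomp Require Import all_boot finmap.

Set Implicit Arguments.
Unset Strict Implicit.
Unset Printing Implicit Defensive.

Record sgraph (T : finType) := SGraph {
  adj :> rel T;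
  adj_sym : symmetric adj;
  adj_irr : irreflexive adj
}.

Section Coloring.
Variables (T : finType) (G : sgraph T).

Definition edges : {set {set T}} := [set [set x; y] | x in T, y in T & G x y].

(* A coloring is total on {set T}; only its values on [edges] are ever used. *)
Definition edge_coloring (C : {set T} -> nat) : Prop :=
  forall f : {set T}, f \in edges -> 0 < C f.

Definition CN (C : {set T} -> nat) (v : T) : {fset nat} :=
  [fset C f | f in edges & v \in f]%fset.

(* A subgraph is given here by its set of edges F. *)
Definition heterochromatic (C : {set T} -> nat) (F : {set {set T}}) : Prop :=
  {in F &, forall f g : {set T}, f != g -> C f != C g}.

End Coloring.

(* Main.v *)
(** Suppose there is no heterochromatic 4-cycle. Fix a vertex [v], choose one
    neighbour for each color of [CN v], let [X] be the set of these neighbours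
    and [S] the set of the vertices outside [X] and [v], so that
    [#|S| = n - 1 - #|CN v|]. A vertex [y <> v] reaches at most one color outside
    [CN v] through [X], since two of them would close a heterochromatic cycle
    through [v]. The hypothesis gives at least [#|S|] colors of [y] outside
    [CN v]; if [y] lies in [S], then [y] is joined to all other vertices of [S] by
    edges of distinct colors. Hence [S] is a properly colored clique, and such a
    clique on 6 vertices contains a heterochromatic 4-cycle, so that
    [#|CN v| >= n - 6] for all [v]. Therefore a color occurs at most 6 times at
    each vertex. Averaging provides a vertex [y <> v] such that at most 6 paths
    [v x y] are monochromatic, and two suitable middle vertices [x], [x'] close a
    heterochromatic cycle [v x y x']. *)

Require Import Defs.
From mathcomp Require Import all_boot finmap zify.

Set Implicit Arguments.
Unset Strict Implicit.
Unset Printing Implicit Defensive.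

(** * Images of finite sets and transversals *)

Lemma leq_card_imfset (T : finType) (K : choiceType) (f : T -> K)
    (A : {set T}) : #|` [fset f x | x in A]%fset| <= #|A|.
Proof. by apply: leq_trans (leq_imfset_card _ _ _) _; rewrite cardE. Qed.

Lemma cardfs_gt1_ex (K : choiceType) (A : {fset K}) :
  1 < #|` A| -> exists x y, [/\ x \in A, y \in A & x != y].
Proof.
move=> A2; have /fset0Pn[x xA] : A != fset0 by rewrite -cardfs_gt0 ltnW.
have /fset0Pn[y] : (A `\ x)%fset != fset0.
  by rewrite -cardfs_gt0; move: A2; rewrite (cardfsD1 x) xA.
by rewrite !inE => /andP[yx yA]; exists x, y; split; rewrite // eq_sym.
Qed.

Lemma image_transversal (T : finType) (K : choiceType) (f : T -> K)
    (A : {set T}) :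
  exists X : {set T}, [/\ X \subset A, {in X &, injective f},
    {in A, forall x, exists2 z, z \in X & f z = f x} &
    #|X| = #|` [fset f x | x in A]%fset|].
Proof.
(* The pick depends on [x] only through [f x], so [r] selects one representative per fibre, and the
   fixed points of [r] form the transversal. *)
pose r x := [pick y in A | f y == f x].
have rP x : x \in A -> exists2 y, r x = Some y & (y \in A) && (f y == f x).
  rewrite /r; case: pickP => [y Py | /(_ x)]; first by exists y.
  by move=> /= xA0 xA; rewrite xA eqxx in xA0.
have r_eq x y : f x = f y -> r x = r y by rewrite /r => ->.
pose X := [set x in A | r x == Some x].
have Xinj : {in X &, injective f}.
  move=> x y; rewrite !inE => /andP[_ /eqP rx] /andP[_ /eqP ry] /r_eq.
  by rewrite rx ry => -[].
have Xsurj : {in A, forall x, exists2 z, z \in X & f z = f x}.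
  move=> x xA; have [z rz /andP[zA /eqP fz]] := rP x xA.
  by exists z => //; rewrite inE zA (r_eq _ _ fz) rz eqxx.
exists X; split=> //.
  by apply/subsetP => x; rewrite inE => /andP[].
have -> : [fset f x | x in A]%fset = [fset f x | x in X]%fset.
  apply/fsetP => c; apply/imfsetP/imfsetP => /= -[x xA ->].
    by have [z zX fz] := Xsurj x xA; exists z.
  by exists x => //; move: xA; rewrite inE => /andP[].
by rewrite card_in_imfset //= -cardE.
Qed.

(** * Colors at a vertex and heterochromatic 4-cycles *)

Section FourCycle.

Variables (T : finType) (G : sgraph T) (C : {set T} -> nat).
Implicit Types (u v x y z : T) (A S X : {set T}).

Definition color x y : nat := C [set x; y].
Definition nbr v : {set T} := [set x | G v x].

Definition has_het_C4 : Prop :=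
  exists x1 x2 x3 x4 : T,
    ucycle G [:: x1; x2; x3; x4] /\
    heterochromatic C
      [set [set x1; x2]; [set x2; x3]; [set x3; x4]; [set x4; x1]].

Lemma colorC x y : color x y = color y x.
Proof. by rewrite /color setUC. Qed.

Lemma adj_neq x y : G x y -> x != y.
Proof. by apply: contraTneq => ->; rewrite adj_irr. Qed.

Lemma CN_imfset v : CN G C v = [fset color v x | x in nbr v]%fset.
Proof.
apply/fsetP => c; apply/imfsetP/imfsetP => /=.
  case=> f; rewrite !inE => /andP[/imset2P[x y _]].
  rewrite !inE => /andP[_ Gxy] -> + ->; rewrite !inE => /orP[]/eqP ->.
    by exists y; rewrite ?inE.
  by exists x; rewrite ?inE 1?adj_sym // colorC.
case=> x; rewrite inE => Gvx ->; exists [set v; x] => //.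
rewrite !inE eqxx andbT; apply/imset2P; exists v x => //.
by rewrite !inE.
Qed.

Lemma mem_CN v x : G v x -> color v x \in CN G C v.
Proof. by move=> Gvx; rewrite CN_imfset; apply: in_imfset; rewrite /= inE. Qed.

Lemma CNP v c : c \in CN G C v -> exists2 x, G v x & c = color v x.
Proof.
rewrite CN_imfset => /imfsetP[/= x]; rewrite inE => Gvx ->.
by exists x.
Qed.

Lemma het_C4_intro a b c d :
  G a b -> G b c -> G c d -> G d a -> a != c -> b != d ->
  uniq [:: color a b; color b c; color c d; color d a] -> has_het_C4.
Proof.
move=> ab bc cd da ac bd u; exists a, b, c, d; split.
  rewrite /ucycle /= ab bc cd da /= !inE !negb_or ac bd.
  by rewrite !adj_neq // adj_sym.
move: u; rewrite /= !inE !negb_or /color.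
case/and4P => /and3P[h1 h2 h3] /andP[h4 h5] h6 _ f g.
rewrite !inE -!orbA => /or4P[] /eqP -> /or4P[] /eqP -> //; rewrite ?eqxx // => _;
  by rewrite // eq_sym.
Qed.

(** This allows the theorem to be proved by contradiction constructively. *)
Lemma het_C4_dec : decidable has_het_C4.
Proof.
pose F x1 x2 x3 x4 : {set {set T}} :=
  [set [set x1; x2]; [set x2; x3]; [set x3; x4]; [set x4; x1]].
apply: (@decP _ [exists x1, exists x2, exists x3, exists x4,
  ucycleb G [:: x1; x2; x3; x4] &&
  [forall f in F x1 x2 x3 x4, forall g in F x1 x2 x3 x4,
     (f != g) ==> (C f != C g)]]).
apply: (iffP existsP) => [[x1]|[x1 [x2 [x3 [x4 [cyc het]]]]]].
  case/existsP=> x2 /existsP[x3 /existsP[x4 /andP[cyc /forall_inP het]]].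
  exists x1, x2, x3, x4; split=> // f g fF gF fg.
  by have /forall_inP/(_ g gF)/implyP := het f fF; apply.
exists x1; apply/existsP; exists x2; apply/existsP; exists x3; apply/existsP.
exists x4; apply/andP; split=> //; apply/forall_inP => f fF.
by apply/forall_inP => g gF; apply/implyP; apply: het.
Qed.

(** Fix [a], [b], [c]. In the cycle [a b c d] consecutive edges already differ, so it fails only if
    [a d] repeats the color of [b c] or [c d] that of [a b]. Properness at [a] and at [c] lets each
    failure occur for at most one [d], so one of three candidates works. *)
Lemma proper_clique_het_C4 S :
  5 < #|S| ->
  {in S &, forall x y, x != y -> G x y} ->
  {in S, forall x, {in S :\ x &, injective (color x)}} ->
  has_het_C4.
Proof.
move=> S6 cliqueS properS.
have := enum_uniq (mem S); have mS z : z \in enum S -> z \in S by rewrite mem_enum.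
move: S6 mS; rewrite cardE.
case: (enum S) => [|a [|b [|c [|d1 [|d2 [|d3 s]]]]]] // _ mS.
have memS z : z \in [:: a; b; c; d1; d2; d3] -> z \in S.
  by move=> zs; apply: mS; rewrite (mem_cat z [:: a; b; c; d1; d2; d3]) zs.
move=> us; have {us} : uniq [:: a; b; c; d1; d2; d3].
  by move: us; rewrite (cat_uniq [:: a; b; c; d1; d2; d3]) => /andP[].
have [aS bS cS] : [/\ a \in S, b \in S & c \in S].
  by split; apply: memS; rewrite !inE eqxx ?orbT.
have dS d : d \in [:: d1; d2; d3] -> d \in S.
  by move=> dd; apply: memS; rewrite (mem_cat d [:: a; b; c]) dd orbT.
have neq x y z : x \in S -> y \in S -> z \in S -> y != x -> z != x -> y != z ->
    color x y != color x z.
  move=> xS yS zS yx zx; apply: contra => /eqP e; apply/eqP.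
  by apply: (properS x) => //; rewrite !inE ?yx ?zx.
rewrite /= !inE !negb_or -!andbA.
case/and5P => ab ac ad1 ad2 /and5P[ad3 bc bd1 bd2 /and5P[bd3 cd1 cd2 cd3]].
case/and4P => d12 d13 d23 _.
have close d : d \in [:: d1; d2; d3] -> a != d -> b != d -> c != d ->
    color a d != color b c -> color c d != color a b -> has_het_C4.
  move=> /dS dinS ad bd cd h1 h2.
  apply: (@het_C4_intro a b c d) => //; try by apply: cliqueS => //; rewrite eq_sym.
  have n1 : color a b != color b c by rewrite colorC neq // eq_sym.
  have n2 : color a b != color a d by rewrite neq // eq_sym.
  have n3 : color b c != color c d by rewrite colorC neq // eq_sym.
  have n4 : color c d != color a d.
    by rewrite colorC (colorC a) neq // eq_sym.
  rewrite /= !inE !negb_or (colorC d a) n1 n2 n3 n4.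
  by rewrite eq_sym h2 eq_sym h1.
have ad d d' : d \in S -> d' \in S -> a != d -> a != d' -> d != d' ->
    color a d != color a d' by move=> *; apply: neq; rewrite // eq_sym.
have cd d d' : d \in S -> d' \in S -> c != d -> c != d' -> d != d' ->
    color c d != color c d' by move=> *; apply: neq; rewrite // eq_sym.
have [d1S d2S d3S] : [/\ d1 \in S, d2 \in S & d3 \in S].
  by split; apply: dS; rewrite !inE eqxx ?orbT.
have := close d1; have := close d2; have := close d3.
rewrite !inE !eqxx !orbT => /(_ isT ad3 bd3 cd3) k3 /(_ isT ad2 bd2 cd2) k2.
move=> /(_ isT ad1 bd1 cd1) k1.
move: (ad _ _ d1S d2S ad1 ad2 d12) (ad _ _ d1S d3S ad1 ad3 d13).
move: (ad _ _ d2S d3S ad2 ad3 d23) (cd _ _ d1S d2S cd1 cd2 d12).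
move: (cd _ _ d1S d3S cd1 cd3 d13) (cd _ _ d2S d3S cd2 cd3 d23).
have [/eqP a1|a1] := boolP (color a d1 == color b c);
have [/eqP a2|a2] := boolP (color a d2 == color b c);
have [/eqP a3|a3] := boolP (color a d3 == color b c);
have [/eqP c1|c1] := boolP (color c d1 == color a b);
have [/eqP c2|c2] := boolP (color c d2 == color a b);
have [/eqP c3|c3] := boolP (color c d3 == color a b);
rewrite ?a1 ?a2 ?a3 ?c1 ?c2 ?c3 ?eqxx //; auto.
Qed.

(** * Color degrees and color classes *)

Lemma color_degree_ge :
  ~ has_het_C4 ->
  (forall u v, u != v -> #|T| - 1 <= #|` (CN G C u `|` CN G C v)%fset|) ->
  forall v, #|T| - 6 <= #|` CN G C v|.
Proof.
move=> noC4 CN_ge v.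
have [X [XN Xinj Xsurj cX]] := image_transversal (color v) (nbr v).
rewrite -CN_imfset in cX; rewrite leqNgt; apply/negP => small.
have vX : v \notin X.
  by apply/negP => /(subsetP XN); rewrite inE adj_irr.
have adjX x : x \in X -> G v x by move/(subsetP XN); rewrite inE.
pose S := ~: (v |: X).
have cS : #|S| + #|X| + 1 = #|T|.
  by have := cardsC (v |: X); rewrite cardsU1 vX -/S; lia.
have key y : y \in S ->
    {in S :\ y, forall z, G y z} /\ {in S :\ y &, injective (color y)}.
  move=> yS; have := yS; rewrite !inE negb_or => /andP[yv yX].
  set D := nbr y :&: (S :\ y).
  set new := (CN G C y `\` CN G C v)%fset.
  have newge : #|S| <= #|` new|.
    have := CN_ge v y; rewrite eq_sym yv => /(_ isT).
    rewrite cardfsU /new cardfsD fsetIC.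
    have := fsubset_leq_card (fsubsetIl (CN G C y) (CN G C v)); lia.
  (* The new colors that [y] reaches through [X]. Two of them, via [x] and [x'], would make
     [v x y x'] heterochromatic: the colors at [v] lie in [CN G C v] and differ since [color v] is
     injective on [X]. *)
  set E := [fset c in new | [exists x in X, G y x && (color y x == c)]]%fset.
  have E1 : #|` E| <= 1.
    rewrite leqNgt; apply/negP.
    case/cardfs_gt1_ex => c [c' []]; rewrite !inE /=.
    case/andP => /andP[cv _] /existsP[x /and3P[xX Gyx /eqP ex]].
    case/andP => /andP[cv' _] /existsP[x' /and3P[xX' Gyx' /eqP ex']] cc'.
    apply: noC4; apply: (@het_C4_intro v x y x') => //; try exact: adjX.
    - by rewrite adj_sym.
    - by rewrite adj_sym adjX.
    - by rewrite eq_sym.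
    - by apply: contraNneq cc' => xx; rewrite -ex -ex' xx.
    rewrite /= !inE !negb_or (colorC x y) ex ex' (colorC x' v) cc' andbT /=.
    have nv z : z \in X -> (color v z != c) && (color v z != c').
      by move=> /adjX /mem_CN zX; apply/andP; split;
        [apply: contraNneq cv | apply: contraNneq cv'] => <-.
    case/andP: (nv x xX) => -> ->; case/andP: (nv x' xX') => /=.
    rewrite !(eq_sym (color v x')) => -> ->; rewrite !andbT.
    apply/eqP => /(Xinj _ _ xX xX') xx; move: cc'.
    by rewrite -ex -ex' xx eqxx.
  have [Y [YD Yinj _ cY]] := image_transversal (color y) D.
  (* The other end of an edge at [y] with a new color is not [v], whose edges have colors in
     [CN G C v]; so it lies in [X] or in [S]. *)
  have newsub : (new `<=` E `|` [fset color y x | x in D])%fset.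
    apply/fsubsetP => c cnew; rewrite inE.
    have [|nE] := boolP (c \in E) => //=.
    move: (cnew); rewrite inE => /andP[cv /CNP[x Gyx ec]].
    rewrite ec in cv cnew nE *; apply: in_imfset => /=.
    rewrite !inE Gyx /= (eq_sym x) (adj_neq Gyx) /= negb_or.
    apply/andP; split.
      by apply: contraNneq cv => xv; rewrite xv colorC mem_CN // adj_sym -xv.
    apply: contra nE => xX; rewrite !inE /=.
    rewrite inE in cnew; rewrite cnew /=.
    by apply/existsP; exists x; rewrite xX Gyx eqxx.
  have Yge : #|S| <= #|Y| + 1.
    have := fsubset_leq_card newsub.
    have := cardfsU E [fset color y x | x in D]%fset.
    by rewrite -cY; lia.
  have cSy : #|S| = #|S :\ y| + 1 by rewrite (cardsD1 y S) yS addnC.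
  have DS : D \subset S :\ y by apply: subsetIr.
  (* [Y] lies in [S :\ y] and has at least [#|S| - 1] elements. Equality yields both adjacency and
     distinctness of the colors. *)
  have YS : Y = S :\ y.
    by apply/eqP; rewrite eqEcard (subset_trans YD DS); lia.
  split; last by rewrite -YS.
  by move=> z; rewrite -YS => /(subsetP YD); rewrite inE inE => /andP[].
(* By [small], [#|X| <= #|T| - 7], hence [#|S| >= 6]. *)
apply: noC4; apply: (@proper_clique_het_C4 S); first by lia.
  by move=> x y xS yS xy; apply: (key x xS).1; rewrite in_setD1 eq_sym xy.
by move=> x xS; apply: (key x xS).2.
Qed.

(** The class yields a single color and each of the other neighbours, at most [#|T| - 1 - #|K|] in
    number, at most one more. *)
Lemma color_class_card v c :
  #|T| - 6 <= #|` CN G C v| ->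
  #|[set x in nbr v | color v x == c]| <= 6.
Proof.
move=> dv; set K := [set x in _ | _].
have KN : K \subset nbr v by apply/subsetP => x; rewrite inE => /andP[].
have Nlt : #|nbr v| < #|T|.
  rewrite -cardsT; apply: proper_card; rewrite properT; apply/eqP => e.
  by have := in_setT v; rewrite -e inE adj_irr.
have sub : (CN G C v `<=` [fset c] `|` [fset color v x | x in nbr v :\: K])%fset.
  apply/fsubsetP => d /CNP[x Gvx ->]; rewrite !inE.
  have [//|dc /=] := eqVneq.
  by apply: in_imfset; rewrite /= !inE Gvx (negbTE dc).
have {sub} := leq_trans dv (fsubset_leq_card sub).
rewrite cardfsU cardfs1 => /leq_trans/(_ (leq_subr _ _)) sub.
have := leq_trans sub (leq_add (leqnn 1) (leq_card_imfset (color v) _)).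
by rewrite cardsDS //; have := subset_leq_card KN; lia.
Qed.

(** * The 4-cycle from large color degrees *)

Lemma large_color_degree_het_C4 :
  60 <= #|T| -> (forall v, #|T| - 6 <= #|` CN G C v|) -> has_het_C4.
Proof.
move=> n60 dc.
have class v c := color_class_card c (dc v).
have degN v : #|~: nbr v| <= 6.
  have := dc v; rewrite CN_imfset; have := leq_card_imfset (color v) (nbr v).
  by have := cardsC (nbr v); lia.
have /card_gt0P[v _] : 0 < #|T| by lia.
pose B y := [set x | [&& G v x, G x y & color x v == color x y]].
have [y yv By] : exists2 y, y != v & #|B y| <= 6.
  apply/exists_inP; apply: contraT; rewrite negb_exists => /forallP noy.
  have lower : 7 * (#|T| - 1) <= \sum_(y | y != v) #|B y|.
    have -> : #|T| - 1 = #|predC1 v| by rewrite cardC1 subn1.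
    rewrite mulnC -sum_nat_const; apply: leq_sum => y yv.
    by have := noy y; rewrite inE in yv; rewrite yv /= -ltnNge.
  (* Count the monochromatic paths [v x y] by their middle vertex: given [x], the vertex [y] lies in
     the class of [color x v] at [x]. *)
  have upper : \sum_(y | y != v) #|B y| <= 6 * (#|T| - 1).
    under eq_bigr do rewrite -sum1dep_card.
    rewrite (exchange_big_dep (fun x => x != v)) /=; last first.
      by move=> y x _ /andP[Gvx _]; rewrite eq_sym adj_neq.
    have -> : #|T| - 1 = #|predC1 v| by rewrite cardC1 subn1.
    rewrite mulnC -sum_nat_const; apply: leq_sum => x _.
    rewrite sum1dep_card; apply: leq_trans (class x (color x v)).
    apply: subset_leq_card; apply/subsetP => y.
    by rewrite !inE => /and4P[_ _ -> /eqP ->] /=.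
  by lia.
have cU A A' : #|A :|: A'| <= #|A| + #|A'| := (leq_card_setU A A').1.
pose bad := ~: nbr v :|: ~: nbr y :|: B y.
have cbad : #|bad| <= 18.
  have := cU (~: nbr v :|: ~: nbr y) (B y).
  have := cU (~: nbr v) (~: nbr y).
  by rewrite /bad; have := degN v; have := degN y; lia.
have notbad x : x \notin bad -> [/\ G v x, G y x & color x v != color x y].
  rewrite !inE !negb_or !negbK => /andP[/andP[vx yx]].
  by rewrite vx (adj_sym G x) yx.
have avoid A : #|A| < #|T| -> exists x, x \notin A.
  move=> cA; have /card_gt0P[x] : 0 < #|~: A| by have := cardsC A; lia.
  by rewrite inE; exists x.
have [x /notbad[vx yx xne]] := avoid bad ltac:(lia).
pose K u c := [set z in nbr u | color u z == c].
pose a := color x v; pose b := color x y.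
(* [x'] must also avoid the colors [a] and [b] at [v] and at [y]: four classes of at most 6
   vertices, so at most 18 + 24 = 42 vertices are excluded. *)
pose bad' := bad :|: (K v a :|: K v b) :|: (K y a :|: K y b).
have [x'] : exists x', x' \notin bad'.
  apply: avoid.
  have := cU (bad :|: (K v a :|: K v b)) (K y a :|: K y b).
  have := cU bad (K v a :|: K v b).
  have := cU (K v a) (K v b); have := cU (K y a) (K y b).
  have := class v a; have := class v b; have := class y a; have := class y b.
  by rewrite /bad' -!/(K _ _); lia.
rewrite /bad' in_setU negb_or in_setU negb_or => /andP[/andP[/notbad[vx' yx' ne']]].
rewrite !inE vx' yx' !negb_or /= => /andP[va vb] /andP[ya yb].
apply: (@het_C4_intro v x y x') => //; rewrite 1?adj_sym 1?eq_sym //.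
  (* [x'] differs from [x] because the edge [v x] has color [a] and [v x'] does not. *)
  by apply: contraNneq va => ->; rewrite /a colorC.
rewrite /= !inE !negb_or (colorC v x) (colorC x' v) -/a -/b xne.
rewrite !(eq_sym a) !(eq_sym b) va vb ya yb /= andbT.
by rewrite (colorC y) (colorC v) eq_sym.
Qed.

End FourCycle.

Theorem theorem6 (T : finType) (G : sgraph T) (C : {set T} -> nat)
  (n_ge60 : 60 <= #|T|)
  (C_col : edge_coloring G C)
  (CN_ge : forall u v : T, u != v -> #|T| - 1 <= #|` (CN G C u `|` CN G C v)%fset |) :
  exists x1 x2 x3 x4 : T,
    ucycle G [:: x1; x2; x3; x4] /\
    heterochromatic C
      [set [set x1; x2]; [set x2; x3]; [set x3; x4]; [set x4; x1]].
Proof.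
have [//|noC4] := het_C4_dec G C.
exact/(large_color_degree_het_C4 n_ge60)/color_degree_ge.
Qed.
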